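(* Let $d\in\mathbb{N}$ and let $b,m\ge 2$ be integers such that $b$ is a prime power and $d\le b+1$. For $N\in\mathbb{N}$, let $\mathcal{S}_N$ be a set of $N$ independent random points, each uniformly distributed in $[0,1)^d$, and let $C_{b,d}(N,m)$ denote the event that $\mathcal{S}_N$ contains a $(0,m,d)$-net in base $b$ as a subset. Consider the convergence \[ \lim_{m,N\to\infty}\mathbb{P}[C_{b,d}(N,m)]=1. \] (i) (Sufficient condition.) If, for some constant $\epsilon>0$, \[ N\ge (1+\epsilon)\, b^{md}\, m\log b, \] then $\mathbb{P}[C_{b,d}(N,m)]\to 1$ as $m\to\infty$ (with $N=N(m)$ chosen accordingly). (ii) (Necessary condition.) In order for this convergence to hold, it is necessary that \[ N\ge \frac{b^{md}}{(b!)^{m(d-1)/b}}, \] and moreover \[ \frac{b^{md}}{(b!)^{m(d-1)/b}}\ge \begin{cases} 2^{m+m(d-1)/2}, & \text{if } b=2,\\[2pt] b^m\left(\exp\left(\frac{1}{b}\bigl(b-2-2(\log b-\log 2)\bigr)\right)\right)^{m(d-1)}, & \text{otherwise.}\end{cases} \]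
   Context: Fix an integer base $b\ge 2$. An elementary interval in base $b$ is a box $E_{\boldsymbol c,\boldsymbol a}=\prod_{j=1}^d\left[\frac{a_j}{b^{c_j}},\frac{a_j+1}{b^{c_j}}\right)$ with $c_j,a_j\in\mathbb{N}_0$ and $0\le a_j<b^{c_j}$. For $m\in\mathbb{N}_0$, a set $P$ of $b^m$ points in $[0,1)^d$ is a $(0,m,d)$-net in base $b$ if every elementary interval $E_{\boldsymbol c,\boldsymbol a}$ with $c_1+\cdots+c_d=m$ contains exactly one point of $P$. Here $\log$ denotes the natural logarithm. *)

(* Defs.v *)
From HB Require Import structures.
From mathcomp Require Export all_boot all_order all_algebra.
From mathcomp Require Export all_classical all_reals all_analysis.
Export Order.TTheory GRing.Theory Num.Theory.
Export numFieldNormedType.Exports.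

Set Implicit Arguments.
Unset Strict Implicit.
Unset Printing Implicit Defensive.

Local Open Scope classical_set_scope.
Local Open Scope ring_scope.

Definition unit_cube (R : realType) (d : nat) : set (d.-tuple R) :=
  [set x | forall j : 'I_d, 0 <= tnth x j < 1].
Arguments unit_cube R d : clear implicits.

Definition elementary_interval (R : realType) (b d : nat)
    (c a : 'I_d -> nat) : set (d.-tuple R) :=
  [set x | forall j : 'I_d,
     (a j)%:R / (b ^ c j)%:R <= tnth x j < (a j).+1%:R / (b ^ c j)%:R].
Arguments elementary_interval R b {d} c a.

Definition is_0md_net (R : realType) (b m d : nat) (Q : set (d.-tuple R)) :=
  [/\ Q `<=` unit_cube R d,
      (Q #= `I_(b ^ m))%card
    & forall c a : 'I_d -> nat,
        (forall j, (a j < b ^ c j)%N) ->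
        (\sum_(j < d) c j = m)%N ->
        exists! x, (Q `&` elementary_interval R b c a) x].

(* The library has no product measure on tuples, so d-dimensional Lebesgue    *)
(* measure is the iterated binary product, transported along (x, t) |-> x :: t *)
Fixpoint lebesgue_tuple (R : realType) (d : nat) : set (d.-tuple R) -> \bar R :=
  match d with
  | 0 => fun A => \d_([tuple] : 0.-tuple R) A
  | n.+1 => fun A =>
      (@lebesgue_measure R \x @lebesgue_tuple R n)%E
        [set p : R * n.-tuple R | A (cons_tuple p.1 p.2)]
  end.
Arguments lebesgue_tuple R d A : clear implicits.

(* lebesgue_tuple of the unit cube is 1, so no normalising factor is needed   *)
Definition uniform_on_cube (R : realType) (disp : measure_display)
    (Omega : measurableType disp) (P : probability Omega R) (d : nat)
    (X : {RV P >-> d.-tuple R}) :=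
  forall A : set (d.-tuple R), measurable A ->
    distribution P X A = lebesgue_tuple R d (A `&` unit_cube R d).

Definition mutually_independent (R : realType) (disp disp' : measure_display)
    (Omega : measurableType disp) (T : measurableType disp')
    (P : probability Omega R) (I : finType) (X : I -> {RV P >-> T}) :=
  forall (J : {set I}) (A : I -> set T),
    (forall i, measurable (A i)) ->
    P (\bigcap_(i in [set` J]) (X i @^-1` A i)) =
    (\prod_(i in J) P (X i @^-1` A i))%E.

Definition contains_net (R : realType) (disp : measure_display)
    (Omega : measurableType disp) (P : probability Omega R) (b d N m : nat)
    (X : 'I_N -> {RV P >-> d.-tuple R}) : set Omega :=
  [set omega | exists2 Q : set (d.-tuple R),
     Q `<=` range (fun i => X i omega) & is_0md_net b m Q].

Definition net_threshold (R : realType) (b d m : nat) : R :=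
  (b ^ (m * d))%:R / (b`!%:R `^ (m%:R * (d%:R - 1) / b%:R)).
Arguments net_threshold R b d m : clear implicits.

(* Main.v *)
Require Import Defs.
From mathcomp Require Import finfield measurable_realfun zify ring lra.

(* Points of the unit cube matter only through the cell of side b^-m that     *)
(* contains them, so a set contains a net iff it meets all b^m cells of some  *)
(* admissible pattern.  Reed-Solomon codes over the field with b elements     *)
(* give a pattern when d <= b + 1, and the union bound over its b^m cells     *)
(* yields (i).  For (ii), a pattern is determined by its first coordinate and *)
(* d - 1 two-dimensional patterns, each of which is a setting of the          *)
(* m * b^(m-1) switches of a butterfly network; hence there are at most       *)
(* (b!)^((d-1) m b^(m-1)) patterns, and the expected number of occurrences    *)
(* below the threshold is at most 1.  To get a bound away from 1, use that    *)
(* occupied cells are distinct if d <= 2 (then the threshold is at most       *)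
(* b^(2m)), and that one switch is redundant if d >= 3.                       *)

Set Implicit Arguments.
Unset Strict Implicit.
Unset Printing Implicit Defensive.

Local Open Scope classical_set_scope.
Local Open Scope ring_scope.

(** By [contains_netE] the event is a finite union, over patterns [g] and injective selections [h]
    of sample points, of events of probability b^(-m d b^m) each. For (i), fix one pattern
    ([separates_exists]). Each of its b^m cells is missed by all points with probability at most
    exp(-N / b^(m d)), so failure has probability at most b^(-eps m) ([prob_contains_net_above]).
    For (ii), the union bound and [card_net_pattern] give a first-moment bound, and
    [net_threshold_exp] says that the threshold is where it equals 1.
    [prob_contains_net_below_threshold] improves 1 to exp(-1/4), uniformly in [m >= 2] and [N], so a
    limit 1 eventually forces N up to the threshold. The explicit lower bound rests on the estimate
    of ln(b!) in [ln_fact_le]. *)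

(** * Polynomials over a finite field and existence of patterns *)

Lemma shift_coef_dvdp (F : fieldType) (p : {poly F}) (a : F) (k : nat) :
  (forall i, (i < k)%N -> (p \Po ('X + a%:P))`_i = 0) ->
  ('X - a%:P) ^+ k %| p.
Proof.
move=> p_coef; set q := p \Po _ in p_coef.
have -> : p = q \Po ('X - a%:P).
  by rewrite /q -comp_polyA comp_polyD comp_polyX comp_polyC subrK comp_polyXr.
rewrite -(poly_take_drop k q) (_ : take_poly k q = 0).
  by rewrite add0r comp_polyM rmorphXn/= comp_polyX dvdp_mull.
by apply/polyP => i; rewrite coef_take_poly coef0; case: ifP => // /p_coef.
Qed.

Lemma prod_XsubC_exp_dvdp (F : fieldType) (p : {poly F}) (e : F -> nat)
    (s : seq F) :
  uniq s -> (forall a, a \in s -> ('X - a%:P) ^+ e a %| p) ->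
  \prod_(a <- s) ('X - a%:P) ^+ e a %| p.
Proof.
elim: s => [|a s IHs] /=; first by rewrite big_nil dvd1p.
case/andP=> a_s s_uniq p_dvd; rewrite big_cons Gauss_dvdp.
  rewrite p_dvd ?mem_head// IHs// => c cs.
  by apply: p_dvd; rewrite inE cs orbT.
rewrite coprimep_expl// coprimep_sym coprimep_XsubC.
apply: contra a_s; rewrite rootE horner_prod prodf_seq_eq0 => /hasP[c cs /=].
by rewrite horner_exp hornerXsubC expf_eq0 subr_eq0 => /andP[_ /eqP ->].
Qed.

Lemma size_prod_XsubC_exp (F : fieldType) (e : F -> nat) (s : seq F) :
  size (\prod_(a <- s) ('X - a%:P) ^+ e a) = (\sum_(a <- s) e a).+1.
Proof.
elim: s => [|a s IHs]; first by rewrite !big_nil size_poly1.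
have monic_prod : \prod_(c <- s) ('X - c%:P) ^+ e c \is monic.
  by apply: monic_prod => c _; rewrite monic_exp// monicXsubC.
by rewrite !big_cons size_Mmonic ?expf_neq0 ?polyXsubC_eq0// IHs size_exp_XsubC addnS.
Qed.

(** Dividing by [b ^ (m - c j)] keeps the leading [c j] of [m] digits, so equal quotients mean a
    common elementary interval. For [b ^ m] indices, counting the [b ^ m] intervals of shape [c]
    then puts exactly one cell in each. *)
Definition separates (b m d : nat) (I : Type) (g : I -> 'I_d -> nat) :=
  forall c : 'I_d -> nat, (\sum_(j < d) c j = m)%N -> forall t t',
    (forall j, g t j %/ b ^ (m - c j) = g t' j %/ b ^ (m - c j))%N -> t = t'.

Definition of_digits (b m : nat) (u : 'I_m -> 'I_b) : nat :=
  (\sum_(i < m) u i * b ^ (m - i.+1))%N.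

Lemma of_digits_recl b m (u : 'I_m.+1 -> 'I_b) :
  of_digits u = (u ord0 * b ^ m + of_digits (fun i => u (lift ord0 i)))%N.
Proof. by rewrite /of_digits big_ord_recl subSS subn0. Qed.

Lemma of_digits_lt b m (u : 'I_m -> 'I_b) : (of_digits u < b ^ m)%N.
Proof.
elim: m u => [|m IHm] u; first by rewrite /of_digits big_ord0.
have := IHm (fun i => u (lift ord0 i)).
have u_lt := ltn_ord (u ord0); rewrite of_digits_recl expnS => v_lt.
by rewrite (leq_trans _ (leq_mul u_lt (leqnn _)))// mulSn addnC ltn_add2r.
Qed.

Lemma of_digits_prefix b m c (u v : 'I_m -> 'I_b) : (c <= m)%N ->
  (of_digits u %/ b ^ (m - c) = of_digits v %/ b ^ (m - c))%N ->
  forall i : 'I_m, (i < c)%N -> u i = v i.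
Proof.
elim: m c u v => [|m IHm] [|c] u v //.
rewrite ltnS => cm; rewrite subSS => uv.
have b_gt0 : (0 < b)%N by rewrite (leq_ltn_trans _ (ltn_ord (u ord0))).
have bP k : (0 < b ^ k)%N by rewrite expn_gt0 b_gt0.
have eq0 : u ord0 = v ord0.
  apply/val_inj => /=; move/(congr1 (divn^~ (b ^ c)%N)): uv.
  rewrite -!divnMA -expnD subnK// !of_digits_recl.
  by rewrite !divnMDl// !divn_small ?addn0 ?of_digits_lt.
move=> i ic; case: (unliftP ord0 i) => [k|] i_def; last by rewrite i_def.
rewrite i_def; apply: (IHm c (u \o lift ord0) (v \o lift ord0)) => //=.
  have bm : (b ^ m = b ^ c * b ^ (m - c))%N by rewrite -expnD subnKC.
  by move: uv; rewrite !of_digits_recl eq0 bm mulnA !divnMDl// => /addnI.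
by move: ic; rewrite i_def.
Qed.

(* The Reed-Solomon (Niederreiter) net: the digits of the j-th coordinate of a *)
(* polynomial of degree < m are its Taylor coefficients at the j-th point of   *)
(* the projective line; m prescribed leading digits determine the polynomial.  *)
Lemma separates_exists (b m d : nat) :
  (exists p k : nat, [/\ prime p, (0 < k)%N & b = (p ^ k)%N]) ->
  (d <= b.+1)%N ->
  exists g : 'I_(b ^ m) -> 'I_d -> nat,
    (forall t j, (g t j < b ^ m)%N) /\ separates b m g.
Proof.
move=> [p [k [p_prime k_gt0 ->]]]; set q := (p ^ k)%N => d_le.
have [F _ Fq] := pPrimePowerField p_prime k_gt0.
pose digit (j : 'I_d) (f : {poly F}) (i : 'I_m) : F :=
  (* Matching on the reflection keeps the proof [jq], needed to name the [j]-th field element. The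
     remaining index [j = q] is the point at infinity, where coefficients are read from the top. *)
  if (j < q)%N =P true is ReflectT jq
  then (f \Po ('X + (enum_val (cast_ord (esym Fq) (Ordinal jq)))%:P))`_i
  else f`_(m - i.+1).
have cardV : #|{: 'rV[F]_m}| = (q ^ m)%N by rewrite card_mx mul1n Fq.
pose f (t : 'I_(q ^ m)) : {poly F} := rVpoly (enum_val (cast_ord (esym cardV) t)).
pose u t j i := cast_ord Fq (enum_rank (digit j (f t) i)).
exists (fun t j => of_digits (u t j)).
split => [t j|c c_sum t t' gtt']; first exact: of_digits_lt.
have c_le j : (c j <= m)%N by rewrite -c_sum (bigD1 j)//= leq_addr.
have dig j (i : 'I_m) : (i < c j)%N -> digit j (f t) i = digit j (f t') i.
  move=> ic; have /cast_ord_inj/enum_rank_inj// : u t j i = u t' j i.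
  exact: of_digits_prefix (gtt' j) _ ic.
suff : f t - f t' = 0.
  move/eqP; rewrite subr_eq0 => /eqP/(can_inj (@rVpolyK _ _))/enum_val_inj.
  exact: cast_ord_inj.
(* [e a] and [e8] are the numbers of digits prescribed at the point [a] and at infinity; a point
   whose index is at least [d] gets the empty sum 0. *)
pose e (a : F) := (\sum_(j < d | j == cast_ord Fq (enum_rank a) :> nat) c j)%N.
pose e8 := (\sum_(j < d | j == q :> nat) c j)%N.
have cdig j i : (i < c j)%N -> exists i' : 'I_m, val i' = i.
  by move=> ic; exists (Ordinal (leq_trans ic (c_le j))).
have e_dvd a : ('X - a%:P) ^+ e a %| f t - f t'.
  apply: shift_coef_dvdp => i; rewrite /e; set r := cast_ord _ _.
  have [rd|dr] := ltnP r d; last first.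
    by rewrite big1// => j /eqP jr; have := ltn_ord j; rewrite jr ltnNge dr.
  rewrite (big_pred1 (Ordinal rd))//= => /[dup] /cdig[i' <-] /dig.
  rewrite /digit; case: eqP => [rq|[]]; last exact: (ltn_ord r).
  rewrite (_ : enum_val _ = a); last first.
    by rewrite (_ : cast_ord _ _ = enum_rank a) ?enum_rankK//; apply: val_inj.
  by rewrite comp_polyB coefB => ->; rewrite subrr.
have e8_size : (size (f t - f t')%R <= m - e8)%N.
  apply/leq_sizeP => i mi; have [im|mi'] := leqP m i.
    rewrite nth_default// (leq_trans _ im)// (leq_trans (size_polyD _ _))//.
    by rewrite size_polyN geq_max !size_poly.
  have [qd|dq] := ltnP q d; last first.
    move: mi; rewrite /e8 big1; first by rewrite subn0 leqNgt mi'.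
    by move=> j /eqP jq; have := ltn_ord j; rewrite jq ltnNge dq.
  move: mi; rewrite /e8 (big_pred1 (Ordinal qd))//= => mi.
  have ic : (m - i.+1 < c (Ordinal qd))%N by lia.
  have [i' i'E] := cdig _ _ ic; rewrite -i'E in ic; have := dig _ _ ic.
  rewrite /digit; case: eqP => [qq|_]; first by exfalso; move: qq; rewrite /= ltnn.
  rewrite i'E (_ : (m - (m - i.+1).+1)%N = i); last by lia.
  by rewrite coefB => ->; rewrite subrr.
have e_sum : (\sum_(a : F) e a + e8 = m)%N.
  rewrite -c_sum /e /e8; under eq_bigr do rewrite big_mkcond/=.
  rewrite exchange_big/= [X in (_ + X)%N]big_mkcond -big_split/=.
  apply: eq_bigr => j _; have [jq|qj] := ltnP j q.
    rewrite ltn_eqF// addn0 -big_mkcond/=.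
    rewrite (big_pred1 (enum_val (cast_ord (esym Fq) (Ordinal jq))))// => a /=.
    apply/eqP/eqP => [ja|->]; last by rewrite enum_valK.
    by rewrite (_ : cast_ord _ _ = enum_rank a) ?enum_rankK//; apply: val_inj.
  rewrite big1 ?add0n => [|a _].
    by rewrite (_ : j == q :> nat)//; have := ltn_ord j; lia.
  case: eqP => // ja; have := ltn_ord (cast_ord Fq (enum_rank a)).
  by move: qj; rewrite ja leqNgt => /negP.
(* A nonzero difference would have degree at least the sum of all [e a], hence size more than
   [m - e8]. *)
apply/eqP/negPn/negP => /dvdp_leq dvd_size.
have := dvd_size _ (prod_XsubC_exp_dvdp (index_enum_uniq F) (fun a _ => e_dvd a)).
rewrite size_prod_XsubC_exp => /leq_trans/(_ e8_size).
by rewrite -e_sum addnK ltnn.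
Qed.

(** * Cell patterns and their projections *)

Section NatPatterns.
Local Open Scope nat_scope.

(* The cell pattern of a net, its points being indexed by their first coordinate. *)
Definition net_pattern (b m n : nat)
    (g : {ffun 'I_(b ^ m) -> {ffun 'I_n.+1 -> 'I_(b ^ m)}}) :=
  (forall t, g t ord0 = t) /\ separates b m (fun t j => val (g t j)).

Lemma net_pattern_exists (b m n : nat) :
  (exists p k : nat, [/\ prime p, 0 < k & b = p ^ k]) -> n <= b ->
  exists g : {ffun 'I_(b ^ m) -> {ffun 'I_n.+1 -> 'I_(b ^ m)}}, net_pattern g.
Proof.
move=> b_primepow n_le; have [g [g_lt g_sep]] := @separates_exists b m n.+1 b_primepow n_le.
(* Shape [(m, 0, ..., 0)] makes the first coordinate injective, hence a bijection by which the
   points can be renumbered. *)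
have first_inj : injective (fun t => Ordinal (g_lt t ord0)).
  move=> t t' [tt']; apply: (g_sep (fun j => if j == ord0 then m else 0)).
    by rewrite big_ord_recl/= big1 ?addn0.
  move=> j; case: eqP => [->|_]; first by rewrite tt'.
  by rewrite subn0 !divn_small.
exists [ffun t => [ffun j => Ordinal (g_lt (invF first_inj t) j)]].
split=> [t|c c_sum t t' tt'].
  by rewrite !ffunE -[RHS](f_invF first_inj).
rewrite -(f_invF first_inj t) -(f_invF first_inj t'); congr (Ordinal (g_lt _ _)).
by apply: (g_sep c c_sum) => j; have := tt' j; rewrite !ffunE.
Qed.

(** This is [separates] for the planar pattern [t |-> (t, y t)]: [c] digits of [t] against [m - c]
    of [y t]. *)
Definition pair_separates (b m : nat) (y : 'I_(b ^ m) -> 'I_(b ^ m)) :=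
  forall c, c <= m -> forall t t' : 'I_(b ^ m),
    t %/ b ^ (m - c) = t' %/ b ^ (m - c) -> y t %/ b ^ c = y t' %/ b ^ c ->
    t = t'.

Lemma net_pattern_pair b m n (g : {ffun 'I_(b ^ m) -> {ffun 'I_n.+1 -> 'I_(b ^ m)}})
    (j : 'I_n) :
  net_pattern g -> pair_separates (fun t => g t (lift ord0 j)).
Proof.
move=> [g0 g_sep] c cm t t' tt' ytt'.
apply: (g_sep (fun i => if i == ord0 then c else
                        if i == lift ord0 j then m - c else 0)).
  rewrite big_ord_recl/= (bigD1 j)//= eqxx big1 ?addn0 ?subnKC// => i ij.
  by rewrite (inj_eq lift_inj) (negPf ij).
move=> i /=; case: eqP => [->|_]; first by rewrite !g0.
case: eqP => [->|_]; first by rewrite subKn.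
by rewrite subn0 !divn_small.
Qed.

(** Shape [(m - 2, 1, 1, 0, ..., 0)]: the interaction of two free coordinates that makes a switch
    redundant. *)
Lemma net_pattern_triple b m n (g : {ffun 'I_(b ^ m) -> {ffun 'I_n.+3 -> 'I_(b ^ m)}})
    (j1 := lift ord0 ord0 : 'I_n.+3) (j2 := lift ord0 (lift ord0 ord0) : 'I_n.+3) :
  2 <= m -> net_pattern g -> forall t t' : 'I_(b ^ m),
    t %/ b ^ 2 = t' %/ b ^ 2 ->
    g t j1 %/ b ^ m.-1 = g t' j1 %/ b ^ m.-1 ->
    g t j2 %/ b ^ m.-1 = g t' j2 %/ b ^ m.-1 -> t = t'.
Proof.
move=> m2 [g0 g_sep] t t' tt' y1 y2.
apply: (g_sep (fun i => if i == ord0 then m - 2 else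
                        if (i == j1) || (i == j2) then 1 else 0)).
  rewrite big_ord_recl (bigD1 ord0)// (bigD1 (lift ord0 ord0))//= big1; first exact: subnK.
  move=> i /andP[i0 i1]; rewrite !(inj_eq lift_inj) (negPf i0).
  by rewrite (negPf i1).
move=> i /=; case: eqP => [->|_]; first by rewrite !g0 subKn.
have [|_] := boolP (_ || _); last by rewrite subn0 !divn_small.
by rewrite subn1 => /orP[] /eqP ->.
Qed.

(** * Counting patterns *)

(* A pair-separating [y] is a setting of the switches of an m-level butterfly  *)
(* network: at level c, the first c digits of t and the first m-1-c digits of  *)
(* y t name a switch, which sends the next digit of t to the next digit of y t. *)
Section Switches.
Variables b m : nat.
Hypotheses (b_gt0 : 0 < b) (m_gt0 : 0 < m).
Implicit Types (y : 'I_(b ^ m) -> 'I_(b ^ m)) (t : 'I_(b ^ m)) (c : 'I_m).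
Implicit Types (w : 'I_(b ^ m.-1)).

Definition switch_index y c t : nat :=
  t %/ b ^ (m - c) * b ^ (m.-1 - c) + y t %/ b ^ c.+1.

Definition input_digit c t : nat := (t %/ b ^ (m.-1 - c)) %% b.

Definition output_digit y c t : nat := (y t %/ b ^ c) %% b.

Definition switch y c w : {ffun 'I_b -> 'I_b} :=
  [ffun s : 'I_b => if [pick t | (switch_index y c t == w) && (input_digit c t == s)]
             is Some t then insubd s (output_digit y c t) else s].

Let expb_gt0 k : 0 < b ^ k. Proof. by rewrite expn_gt0 b_gt0. Qed.

Let divn_lt_exp (k i : nat) (x : 'I_(b ^ m)) : m = k + i -> x %/ b ^ k < b ^ i.
Proof. by move=> mE; rewrite ltn_divLR// -expnD addnC -mE. Qed.

Lemma switch_index_lt y c t : switch_index y c t < b ^ m.-1.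
Proof.
have cm := ltn_ord c.
have t_lt : t %/ b ^ (m - c) < b ^ c by apply: divn_lt_exp; lia.
have y_lt : y t %/ b ^ c.+1 < b ^ (m.-1 - c) by apply: divn_lt_exp; lia.
rewrite (_ : b ^ m.-1 = b ^ c * b ^ (m.-1 - c)); last by rewrite -expnD; congr (_ ^ _); lia.
rewrite /switch_index (leq_trans _ (leq_mul t_lt (leqnn _)))//.
by rewrite mulSn [X in _ < X]addnC ltn_add2l.
Qed.

Lemma switch_index_inj y y' c t t' :
  switch_index y c t = switch_index y' c t' ->
  t %/ b ^ (m - c) = t' %/ b ^ (m - c) /\ y t %/ b ^ c.+1 = y' t' %/ b ^ c.+1.
Proof.
have cm := ltn_ord c.
have y_lt (x : 'I_(b ^ m)) : x %/ b ^ c.+1 < b ^ (m.-1 - c).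
  by apply: divn_lt_exp; lia.
move=> eqw; split.
  move/(congr1 (divn^~ (b ^ (m.-1 - c)))): eqw.
  by rewrite /switch_index/= !divnMDl// !(divn_small (y_lt _)) !addn0.
move/(congr1 (modn^~ (b ^ (m.-1 - c)))): eqw.
by rewrite /switch_index/= !modnMDl !(modn_small (y_lt _)).
Qed.

Let divn_digit k (x : nat) : x %/ b ^ k = x %/ b ^ k.+1 * b + (x %/ b ^ k) %% b.
Proof. by rewrite expnSr divnMA -divn_eq. Qed.

Let divn_input c t :
  t %/ b ^ (m - c.+1) = t %/ b ^ (m - c) * b + input_digit c t.
Proof.
have cm := ltn_ord c; rewrite /input_digit (_ : m.-1 - c = m - c.+1); last lia.
by rewrite [LHS]divn_digit (_ : (m - c.+1).+1 = m - c)//; lia.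
Qed.

Lemma switch_input_inj y c t t' : pair_separates y ->
  switch_index y c t = switch_index y c t' ->
  input_digit c t = input_digit c t' -> t = t'.
Proof.
move=> y_sep /switch_index_inj[tt' ytt'] dtt'.
by apply: (y_sep c.+1) => //; rewrite !divn_input tt' dtt'.
Qed.

Lemma switch_output_inj y c t t' : pair_separates y ->
  switch_index y c t = switch_index y c t' ->
  output_digit y c t = output_digit y c t' -> t = t'.
Proof.
move=> y_sep /switch_index_inj[tt' ytt'] dtt'.
apply: (y_sep c) => //; first exact: ltnW.
by rewrite divn_digit [RHS]divn_digit ytt' -!/(output_digit _ _ _) dtt'.
Qed.

(** Index and input digit together embed the [b ^ m] points into [b ^ m.-1 * b] pairs, so every pair
    occurs by counting. *)
Lemma switch_input_surj y c w (s : 'I_b) : pair_separates y ->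
  exists2 t, switch_index y c t = w & input_digit c t = s.
Proof.
move=> y_sep.
pose f t := (Ordinal (switch_index_lt y c t),
             Ordinal (ltn_pmod (t %/ b ^ (m.-1 - c)) b_gt0)).
have f_inj : injective f by move=> t t' [wtt' dtt']; exact: (switch_input_inj y_sep wtt' dtt').
have [|f' _ fK] := inj_card_bij f_inj.
  by rewrite card_prod !card_ord -expnSr prednK.
by exists (f' (w, s));
  [move/(congr1 (val \o fst)): (fK (w, s)) | move/(congr1 (val \o snd)): (fK (w, s))].
Qed.

Lemma switchE y c w (s : 'I_b) t : pair_separates y ->
  switch_index y c t = w -> input_digit c t = s ->
  switch y c w s = output_digit y c t :> nat.
Proof.
move=> y_sep tw ts; rewrite ffunE; case: pickP => [t' /andP[/eqP t'w /eqP t's]|].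
  rewrite (@switch_input_inj y c t' t)// ?tw ?ts//.
  by rewrite val_insubd ltn_pmod.
by move/(_ t); rewrite tw ts !eqxx.
Qed.

Lemma switch_inj y c w : pair_separates y -> injective (switch y c w).
Proof.
move=> y_sep s s' ss'.
have [t tw ts] := switch_input_surj c w s y_sep.
have [t' t'w t's'] := switch_input_surj c w s' y_sep.
apply: val_inj; rewrite /= -ts -t's'; congr input_digit.
apply: (@switch_output_inj y c) => //; first by rewrite tw t'w.
by rewrite -(switchE y_sep tw ts) -(switchE y_sep t'w t's') ss'.
Qed.

(** One step of decoding, going down in [c]: [t] and the leading digits of [y t] locate a switch and
    its input, and the switch returns the next digit of [y t]. *)
Lemma switch_prefix y y' c t : pair_separates y -> pair_separates y' ->
  y t %/ b ^ c.+1 = y' t %/ b ^ c.+1 ->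
  switch y c (Ordinal (switch_index_lt y c t)) =
  switch y' c (Ordinal (switch_index_lt y c t)) ->
  y t %/ b ^ c = y' t %/ b ^ c.
Proof.
move=> y_sep y'_sep ytt' sw.
rewrite divn_digit [RHS]divn_digit ytt' -!/(output_digit _ _ _).
have dE : input_digit c t = Ordinal (ltn_pmod (t %/ b ^ (m.-1 - c)) b_gt0) by [].
have wE : switch_index y c t = Ordinal (switch_index_lt y c t) by [].
rewrite -(switchE y_sep wE dE) sw (@switchE y' c _ _ t)//.
by rewrite /switch_index /= ytt'.
Qed.

End Switches.

Section PatternCount.
Variables b m n : nat.
Hypotheses (b_gt0 : 0 < b) (m_gt0 : 0 < m).
Local Notation pattern := {ffun 'I_(b ^ m) -> {ffun 'I_n.+1 -> 'I_(b ^ m)}}.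
Local Notation switches := ('I_n * 'I_m * 'I_(b ^ m.-1))%type.

Definition pattern_switch (g : pattern) (x : switches) : {ffun 'I_b -> 'I_b} :=
  switch (fun t => g t (lift ord0 x.1.1)) x.1.2 x.2.

(** Iterates [switch_prefix]. Agreement is asked only for the switches on the path of [t], which
    lets [card_net_pattern_dim3] bypass one switch. *)
Lemma pattern_switch_prefix (g g' : pattern) (j : 'I_n) (t : 'I_(b ^ m))
    (c0 c1 : nat) :
  net_pattern g -> net_pattern g' -> c0 <= c1 <= m ->
  g t (lift ord0 j) %/ b ^ c1 = g' t (lift ord0 j) %/ b ^ c1 ->
  (forall c : 'I_m, c0 <= c < c1 ->
     forall w : 'I_(b ^ m.-1),
       w = switch_index (fun t => g t (lift ord0 j)) c t :> nat ->
     pattern_switch g (j, c, w) = pattern_switch g' (j, c, w)) ->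
  g t (lift ord0 j) %/ b ^ c0 = g' t (lift ord0 j) %/ b ^ c0.
Proof.
move=> g_net g'_net /andP[c01 c1m] eq1 sw.
suff prefix k c : c0 <= c -> c1 = k + c ->
    g t (lift ord0 j) %/ b ^ c = g' t (lift ord0 j) %/ b ^ c.
  by apply: (prefix (c1 - c0)); rewrite ?subnK.
elim: k c => [|k IHk] c c0c c1E; first by rewrite add0n in c1E; rewrite -c1E.
have cc1 : c < c1 by rewrite c1E addSn ltnS leq_addl.
have /= := @switch_prefix _ _ b_gt0 m_gt0 _ _ (Ordinal (leq_trans cc1 c1m)) t
          (net_pattern_pair (j := j) g_net) (net_pattern_pair (j := j) g'_net).
apply.
  by apply: IHk; rewrite 1?ltnW// c1E addSnnS.
by apply: sw => //=; rewrite c0c.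
Qed.

Lemma net_pattern_ext (g g' : pattern) : net_pattern g -> net_pattern g' ->
  (forall j t, g t (lift ord0 j) = g' t (lift ord0 j) :> nat) -> g = g'.
Proof.
move=> [g0 _] [g'0 _] gg'; apply/ffunP => t; apply/ffunP => i.
case: (unliftP ord0 i) => [j|] ->; last by rewrite g0 g'0.
exact/val_inj/gg'.
Qed.

(** Each switch in [D] is an injective self-map of ['I_b], one of b! choices. The code is the
    identity outside [D], so patterns inject into the functions supported on [D]. *)
Lemma card_net_pattern_le (D : {set switches}) :
  (forall g g' : pattern, net_pattern g -> net_pattern g' ->
     {in D, pattern_switch g =1 pattern_switch g'} -> g = g') ->
  #|[set g : pattern | `[< net_pattern g >]]%SET| <= b`! ^ #|D|.
Proof.
move=> D_inj; set S := [set g | _]%SET.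
have netS g : g \in S -> net_pattern g by rewrite inE => /asboolP.
pose code (g : pattern) :=
  [ffun x => if x \in D then pattern_switch g x else [ffun s => s]].
have code_inj : {in S &, injective code}.
  move=> g g' /netS g_net /netS g'_net /ffunP gg'; apply: D_inj => // x xD.
  by have := gg' x; rewrite !ffunE xD.
pose injs := [set f : {ffun 'I_b -> 'I_b} | injectiveb f]%SET.
have injs_card : #|injs| = b`! by rewrite card_inj_ffuns !card_ord ffactnn.
rewrite -(card_in_imset code_inj) -injs_card.
rewrite -(card_pffun_on [ffun s => s] (mem D) (mem injs)).
apply/subset_leq_card/fintype.subsetP => _ /imsetP[g /netS g_net ->].
apply/pffun_onP; split.
  by apply/fintype.subsetP => x; rewrite inE ffunE; case: ifP; rewrite ?eqxx.
move=> _ /fintype.imageP[x xD ->]; rewrite inE ffunE xD.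
by apply/injectiveP/switch_inj => //; exact: net_pattern_pair.
Qed.

Lemma card_net_pattern :
  #|[set g : pattern | `[< net_pattern g >]]%SET| <= b`! ^ (n * m * b ^ m.-1).
Proof.
have -> : n * m * b ^ m.-1 = #|[set: switches]%SET|.
  by rewrite cardsT !card_prod !card_ord.
apply: card_net_pattern_le => g g' g_net g'_net sw; apply: net_pattern_ext => // j t.
rewrite -[LHS](divn1 _) -[RHS](divn1 _) -(expn0 b).
(* Decoding starts at level [m], where both quotients are 0, and ends at level 0 with the full
   coordinate. *)
apply: (@pattern_switch_prefix _ _ _ _ 0 m) => //; rewrite ?leqnn ?divn_small//.
by move=> c _ w _; apply: sw; rewrite inE.
Qed.

End PatternCount.

(* In dimension at least 3 one switch is redundant: on the b^2 points with     *)
(* t < b^2 the leading digits of coordinates 1 and 2 form all b^2 pairs, so    *)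
(* the second leading digits for t < b are forced by the other blocks.         *)
Lemma card_net_pattern_dim3 (b m n : nat) : 0 < b -> 2 <= m ->
  #|[set g : {ffun 'I_(b ^ m) -> {ffun 'I_n.+3 -> 'I_(b ^ m)}}
    | `[< net_pattern g >]]%SET| <= b`! ^ (n.+2 * m * b ^ m.-1).-1.
Proof.
move=> b_gt0 m2; have m_gt0 : 0 < m by exact: ltnW.
have bP k : 0 < b ^ k by rewrite expn_gt0 b_gt0.
have mlt : m.-1 < m by rewrite prednK.
pose j1 : 'I_n.+2 := ord0; pose j2 : 'I_n.+2 := lift ord0 ord0.
(* The omitted switch gives the leading digit of the second free coordinate on the block [t < b]
   (see [index0]). *)
pose x0 := (j2, Ordinal mlt, Ordinal (bP m.-1)).
have -> : (n.+2 * m * b ^ m.-1).-1 = #|[set~ x0]%SET|.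
  by rewrite cardsC1 !card_prod !card_ord.
apply: card_net_pattern_le => // g g' g_net g'_net sw.
have sw_neq x : x != x0 -> pattern_switch g x = pattern_switch g' x.
  by move=> xx0; apply: sw; rewrite !inE.
have coord1 j t : j != j2 -> g t (lift ord0 j) = g' t (lift ord0 j) :> nat.
  move=> jj2; rewrite -[LHS](divn1 _) -[RHS](divn1 _) -(expn0 b).
  apply: (@pattern_switch_prefix _ _ _ b_gt0 m_gt0 _ _ _ _ 0 m) => //; rewrite ?leqnn ?divn_small//.
  move=> c _ w _; apply: sw_neq.
  by apply: contra jj2 => /eqP[-> _ _].
have index0 (y : 'I_(b ^ m) -> 'I_(b ^ m)) t :
    switch_index y (Ordinal mlt) t = t %/ b.
  rewrite /switch_index/= prednK// (divn_small (ltn_ord (y t))) addn0 subnn muln1.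
  by rewrite (_ : m - m.-1 = 1) ?expn1// -{1}(prednK m_gt0) subSnn.
have lead2_ge (t : 'I_(b ^ m)) : b <= t ->
    g t (lift ord0 j2) %/ b ^ m.-1 = g' t (lift ord0 j2) %/ b ^ m.-1.
  move=> bt; apply: (@pattern_switch_prefix _ _ _ b_gt0 m_gt0 _ _ _ _ m.-1 m) => //.
  - by rewrite leq_pred leqnn.
  - by rewrite !divn_small.
  move=> c cm w wE; apply: sw_neq.
  apply/eqP => -[cE w0]; move: wE; rewrite w0 cE index0 => /esym/eqP.
  by rewrite -leqn0 leqNgt divn_gt0// bt.
have lead2 (t0 : 'I_(b ^ m)) : g t0 (lift ord0 j2) %/ b ^ m.-1 = g' t0 (lift ord0 j2) %/ b ^ m.-1.
  have [t0b|] := ltnP t0 b; last exact: lead2_ge.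
  have b2_lt : b ^ 2 <= b ^ m by rewrite leq_pexp2l.
  pose wid (t : 'I_(b ^ 2)) : 'I_(b ^ m) := widen_ord b2_lt t.
  have lead_lt (x : 'I_(b ^ m)) : x %/ b ^ m.-1 < b.
    by rewrite ltn_divLR// -expnS prednK.
  pose lead (t : 'I_(b ^ 2)) : 'I_b * 'I_b :=
    (Ordinal (lead_lt (g' (wid t) (lift ord0 j1))),
     Ordinal (lead_lt (g' (wid t) (lift ord0 j2)))).
  have lead_inj : injective lead.
    move=> t t' [l1 l2]; apply/val_inj.
    have /(congr1 val)// : wid t = wid t'.
    apply: (net_pattern_triple m2 g'_net) => //.
    have wid_small s : wid s %/ b ^ 2 = 0 by apply: divn_small; exact: (ltn_ord s).
    by rewrite !wid_small.
  have [|lead' _ leadK] := inj_card_bij lead_inj.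
    by rewrite card_prod !card_ord mulnn.
  pose l0 := (Ordinal (lead_lt (g t0 (lift ord0 j1))),
              Ordinal (lead_lt (g t0 (lift ord0 j2)))).
  set t' := wid (lead' l0).
  have e1 : g' t' (lift ord0 j1) %/ b ^ m.-1 = g t0 (lift ord0 j1) %/ b ^ m.-1.
    exact: (congr1 (fun l => val l.1) (leadK l0)).
  have e2 : g' t' (lift ord0 j2) %/ b ^ m.-1 = g t0 (lift ord0 j2) %/ b ^ m.-1.
    exact: (congr1 (fun l => val l.2) (leadK l0)).
  rewrite -coord1// in e1.
  (* [t'] has in [g'] the pair of leading digits that [t0] has in [g]. If [t' < b], both share a
     block and the first leading digit, so the planar condition on [g] identifies them. Otherwise
     [lead2_ge] transfers the second digit to [g], and the triple condition applies. *)
  suff t'E : t' = t0 by rewrite -e2 t'E.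
  have [t'b|bt'] := ltnP t' b.
    apply: (net_pattern_pair (j := j1) g_net (leq_pred m)) => //.
    rewrite (_ : m - m.-1 = 1); last by rewrite -{1}(prednK m_gt0) subSnn.
    by rewrite expn1 !divn_small.
  rewrite -lead2_ge// in e2.
  apply: (net_pattern_triple m2 g_net) => //.
  have t0b2 : t0 < b ^ 2 by rewrite (leq_trans t0b)// -{1}(expn1 b) leq_pexp2l.
  by rewrite !divn_small//; exact: ltn_ord (lead' l0).
apply: net_pattern_ext => // j t; have [->|] := eqVneq j j2; last exact: coord1.
rewrite -[LHS](divn1 _) -[RHS](divn1 _) -(expn0 b).
apply: (@pattern_switch_prefix _ _ _ b_gt0 m_gt0 _ _ _ _ 0 m.-1) => //.
  by rewrite leq_pred.
move=> c cm w _; apply: sw_neq; apply/eqP => -[cE _].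
by move: cm; rewrite cE/= ltnn.
Qed.

End NatPatterns.

(** * Measures of boxes and the grid of cells *)

Lemma measure_bigcup_pred_le (d : measure_display) (T : measurableType d)
    (R : realType) (mu : {measure set T -> \bar R}) (I : finType) (Q : {pred I})
    (F : I -> set T) :
  (forall i, measurable (F i)) ->
  (mu (\bigcup_(i in [set` Q]) F i) <= \sum_(i in Q) mu (F i))%E.
Proof.
move=> mF; rewrite bigcup_pred.
suff [] : measurable (\big[setU/set0]_(i in Q) F i) /\
  (mu (\big[setU/set0]_(i in Q) F i) <= \sum_(i in Q) mu (F i))%E by [].
apply: (big_ind2 (fun A s => measurable A /\ (mu A <= s)%E)).
- by rewrite measure0.
- move=> A s B s' [mA As] [mB Bs']; split; first exact: measurableU.
  by apply: le_trans (measureU2 _ _ _) _ => //; exact: leeD.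
- by move=> i _; split.
Qed.

Lemma measurable_elementary_interval (R : realType) (b d : nat)
    (c a : 'I_d -> nat) : measurable (elementary_interval R b c a).
Proof.
rewrite (_ : elementary_interval R b c a = \bigcap_(j in [set: 'I_d])
  ((@tnth d R)^~ j @^-1` `[(a j)%:R / (b ^ c j)%:R, (a j).+1%:R / (b ^ c j)%:R[)).
  apply: fin_bigcap_measurable => // j _.
  rewrite -[X in measurable X]setTI.
  exact: (measurable_tnth j).
by apply/seteqP; split=> x /= xE j; have := xE j; rewrite /= in_itv//=; apply.
Qed.

Lemma lebesgue_tuple0 (R : realType) (d : nat) : lebesgue_tuple R d set0 = 0%E.
Proof.
elim: d => [|d IHd] /=; first by rewrite dirac0.
rewrite (_ : [set p | _] = set0)//.
rewrite /product_measure1 (eq_integral (cst 0%E)) ?integral0// => x _ /=.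
by rewrite xsection0.
Qed.

(** The section at [x] is the box of the remaining coordinates if [x] lies in the first side, and
    empty otherwise; the outer integral is that of a constant times an indicator. *)
Lemma lebesgue_tuple_box (R : realType) (d : nat) (u v : 'I_d -> R) :
  (forall j, u j <= v j) ->
  lebesgue_tuple R d [set x | forall j, u j <= tnth x j < v j] =
  (\prod_(j < d) (v j - u j))%:E.
Proof.
elim: d u v => [|d IHd] u v uv /=.
  by rewrite big_ord0 diracE mem_set// => -[].
rewrite /product_measure1.
pose r := \prod_(j < d) (v (lift ord0 j) - u (lift ord0 j)).
have r_ge0 : 0 <= r by apply: prodr_ge0 => j _; rewrite subr_ge0.
rewrite (eq_integral (fun x : measurableTypeR R =>
    r%:E * (\1_(`[u ord0, v ord0[ : set (measurableTypeR R)) x)%:E)%E).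
  have mI : measurable_fun [set: measurableTypeR R]
      (fun x => (\1_(`[u ord0, v ord0[ : set (measurableTypeR R)) x : R)%:E).
    by apply/measurable_EFinP; exact: measurable_indic.
  rewrite ge0_integralZl//.
  rewrite integral_indic// setIT big_ord_recl -/r mulrC EFinM; congr (_ * _)%E.
  apply: (etrans (lebesgue_measure_itv `[u ord0, v ord0[)); rewrite /= lte_fin.
  by have := uv ord0; rewrite le_eqVlt => /predU1P[->|->]; rewrite ?ltxx ?subrr.
move=> x _ /=; rewrite indicE; have [xI|xI] := boolP (x \in _).
  rewrite mule1 -IHd//; congr lebesgue_tuple; apply/seteqP; split=> t /=.
    rewrite /xsection/= => /set_mem /= xt j.
    by have := xt (lift ord0 j); rewrite tnthS.
  move=> tE; rewrite /xsection/=; apply/mem_set => /= j.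
  case: (unliftP ord0 j) => [k|] ->; first by rewrite tnthS.
  by rewrite tnth0; move: xI; rewrite inE/= in_itv.
rewrite mule0 -[RHS](lebesgue_tuple0 R d); congr lebesgue_tuple.
apply/seteqP; split=> t //=; rewrite /xsection/= => /set_mem /= xt.
move/negP: xI; apply; rewrite inE/= in_itv/=.
by have := xt ord0; rewrite tnth0.
Qed.

(** The endpoints of the interval lie on the grid of step 1/b^m, so within one cell membership is a
    comparison of integers. *)
Lemma elementary_interval_refine (R : realType) (b d m : nat) (c a k : 'I_d -> nat)
    (x : d.-tuple R) :
  (0 < b)%N -> (forall j, (c j <= m)%N) ->
  elementary_interval R b (fun=> m) k x ->
  elementary_interval R b c a x <->
  (forall j, k j %/ b ^ (m - c j) = a j)%N.
Proof.
move=> b_gt0 c_le xk.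
have bP i : 0 < (b ^ i)%:R :> R by rewrite ltr0n expn_gt0 b_gt0.
have side j (e : nat) : (e%:R / (b ^ c j)%:R <= tnth x j) =
    (e * b ^ (m - c j) <= k j)%N.
  have /andP[kx xk1] := xk j.
  rewrite ler_pdivrMr// -(ler_pM2r (bP (m - c j)%N)) -mulrA -!natrM -expnD.
  rewrite subnKC//; rewrite ler_pdivrMr// in kx; rewrite ltr_pdivlMr// in xk1.
  apply/idP/idP => [ex|ek].
    by rewrite -ltnS -(ltr_nat R) (le_lt_trans ex).
  by rewrite (le_trans _ kx)// ler_nat.
have bcP j : (0 < b ^ (m - c j))%N by rewrite expn_gt0 b_gt0.
split=> xE j; have := xE j.
  rewrite ltNge !side -ltnNge => /andP[ak ka].
  by apply/eqP; rewrite eqn_leq leq_divRL// ak andbT -ltnS ltn_divLR.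
move=> <-; rewrite ltNge !side -ltnNge leq_divM//= -ltn_divLR//.
Qed.

Lemma elementary_interval_unit_cube (R : realType) (b d : nat) (c a : 'I_d -> nat) :
  (0 < b)%N -> (forall j, (a j < b ^ c j)%N) ->
  elementary_interval R b c a `<=` unit_cube R d.
Proof.
move=> b_gt0 a_lt x xE j; have /andP[ax xa] := xE j.
have bP : 0 < (b ^ c j)%:R :> R by rewrite ltr0n expn_gt0 b_gt0.
rewrite (le_trans _ ax) ?divr_ge0//= (lt_le_trans xa)//.
by rewrite ler_pdivrMr// mul1r ler_nat.
Qed.

Definition cell (R : realType) (b d m : nat) (k : {ffun 'I_d -> 'I_(b ^ m)}) :
    set (d.-tuple R) :=
  elementary_interval R b (fun=> m) (fun j => k j).

Lemma unit_cube_cell (R : realType) (b d m : nat) (x : d.-tuple R) :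
  (0 < b)%N -> unit_cube R d x ->
  exists k : {ffun 'I_d -> 'I_(b ^ m)}, cell k x.
Proof.
move=> b_gt0 x01.
have bP : 0 < (b ^ m)%:R :> R by rewrite ltr0n expn_gt0 b_gt0.
have x_ge0 j : 0 <= tnth x j * (b ^ m)%:R.
  by rewrite mulr_ge0//; have /andP[] := x01 j.
have k_lt j : (Num.truncn (tnth x j * (b ^ m)%:R) < b ^ m)%N.
  rewrite truncn_lt_nat// -[X in _ < X]mul1r ltr_pM2r//.
  by have /andP[] := x01 j.
exists [ffun j => Ordinal (k_lt j)] => j; rewrite ffunE/=.
by rewrite ler_pdivrMr// ltr_pdivlMr// truncn_itv.
Qed.

Lemma cell_inj (R : realType) (b d m : nat) (k k' : {ffun 'I_d -> 'I_(b ^ m)})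
    (x : d.-tuple R) : (0 < b)%N -> cell k x -> cell k' x -> k = k'.
Proof.
move=> b_gt0 xk xk'; apply/ffunP => j; apply/val_inj => /=.
have := elementary_interval_refine (fun j => k' j) b_gt0 (fun=> leqnn m) xk.
move=> [/(_ xk') /(_ j) + _].
by rewrite subnn divn1.
Qed.

Lemma cell_in_unit_cube (R : realType) (b d m : nat)
    (k : {ffun 'I_d -> 'I_(b ^ m)}) :
  (0 < b)%N -> cell k `<=` unit_cube R d.
Proof. by move=> b_gt0; apply: elementary_interval_unit_cube. Qed.

Lemma lebesgue_tuple_cell (R : realType) (b d m : nat)
    (k : {ffun 'I_d -> 'I_(b ^ m)}) :
  (0 < b)%N -> lebesgue_tuple R d (cell k) = ((b ^ (m * d))%:R^-1)%:E.
Proof.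
move=> b_gt0; have bP : 0 < (b ^ m)%:R :> R by rewrite ltr0n expn_gt0 b_gt0.
rewrite lebesgue_tuple_box => [|j]; last by rewrite ler_pM2r ?invr_gt0// ler_nat.
congr (_%:E); under eq_bigr do rewrite -mulrBl -natrB ?leqnSn// subSnn mul1r.
by rewrite prodr_const card_ord exprVn expnM [in RHS]natrX.
Qed.

(** * Nets and patterns *)

Section NetEvents.
Variables (R : realType) (disp : measure_display) (Omega : measurableType disp).
Variables (P : probability Omega R) (b m n N : nat).
Variable X : 'I_N -> {RV P >-> n.+1.-tuple R}.
Hypothesis b_gt0 : (0 < b)%N.
Local Notation pattern := {ffun 'I_(b ^ m) -> {ffun 'I_n.+1 -> 'I_(b ^ m)}}.
Local Notation selection := {ffun 'I_(b ^ m) -> 'I_N}.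
Implicit Types (g : pattern) (h : selection).

Definition realizes g h : set Omega :=
  [set omega | forall t, cell (g t) (X (h t) omega)].

Lemma realizes_contains_net g h :
  net_pattern g -> realizes g h `<=` contains_net b m X.
Proof.
move=> [g0 g_sep] omega gh; pose x t := X (h t) omega.
have x_inj : injective x.
  move=> t t' xtt'; have := gh t; rewrite -/(x t) xtt' => gt.
  by rewrite -(g0 t) -(g0 t') (cell_inj b_gt0 gt (gh t')).
exists (range x); first by move=> _ [t _ <-]; exists (h t).
split.
- by move=> _ [t _ <-]; exact: (cell_in_unit_cube b_gt0 (gh t)).
- apply: card_eq_trans (inj_card_eq _) _; first by move=> ? ? _ _; exact: x_inj.
  by rewrite card_eq_sym card_II.
move=> c a a_lt c_sum.
have c_le j : (c j <= m)%N by rewrite -c_sum (bigD1 j)//= leq_addr.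
have pre_lt t j : (g t j %/ b ^ (m - c j) < b ^ c j)%N.
  by rewrite ltn_divLR ?expn_gt0 ?b_gt0// -expnD subnKC.
(* [pre t] names the interval of shape [c] holding point [t]. Separation makes [pre] injective into
   a set of [b ^ m] intervals, so the interval [a] is hit exactly once. *)
pose pre t : {dffun forall j : 'I_n.+1, 'I_(b ^ c j)} :=
  [ffun j : 'I_n.+1 => Ordinal (pre_lt t j)].
have pre_inj : injective pre.
  move=> t t' tt'; apply: (g_sep c c_sum) => j.
  have : pre t j = pre t' j by rewrite tt'.
  by rewrite !ffunE => /(congr1 val).
have [|inv _ invK] := inj_card_bij pre_inj.
  rewrite card_dep_ffun foldrE big_map big_enum/= card_ord.
  under eq_bigr do rewrite card_ord.
  by rewrite -expn_sum c_sum.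
pose t0 := inv [ffun j => Ordinal (a_lt j)].
have t0E j : (g t0 j %/ b ^ (m - c j) = a j)%N.
  have : pre t0 j = Ordinal (a_lt j) by rewrite invK ffunE.
  by rewrite ffunE => /(congr1 val).
exists (x t0); split.
  by split; [exists t0 | apply/(elementary_interval_refine _ b_gt0 c_le (gh t0))].
move=> _ [[t _ <-] /(elementary_interval_refine _ b_gt0 c_le (gh t)) tE].
by congr x; apply: (g_sep c c_sum) => j; rewrite t0E tE.
Qed.

Lemma contains_net_realizes omega : contains_net b m X omega ->
  exists g h, [/\ net_pattern g, injective h & realizes g h omega].
Proof.
move=> [Q QX [Q01 _ Qnet]].
(* This shape cuts the cube into [b ^ m] slabs along the first coordinate; the unique net point of
   slab [t] receives the index [t]. *)
pose c0 (j : 'I_n.+1) := (if j == ord0 then m else 0)%N.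
pose a0 (t : 'I_(b ^ m)) (j : 'I_n.+1) := (if j == ord0 then val t else 0)%N.
have a0_lt t j : (a0 t j < b ^ c0 j)%N.
  by rewrite /a0 /c0; case: ifP => _ /=; rewrite ?expn0 ?ltn_ord.
have c0_sum : (\sum_(j < n.+1) c0 j = m)%N by rewrite big_ord_recl/= big1 ?addn0.
have c0_le j : (c0 j <= m)%N by rewrite /c0; case: ifP.
have /choice[x xP] t : exists x, (Q `&` elementary_interval R b c0 (a0 t)) x.
  by have [x [Qx _]] := Qnet c0 (a0 t) (a0_lt t) c0_sum; exists x.
have /choice[h hP] t : exists i, X i omega = x t.
  by have [/QX[i _ <-] _] := xP t; exists i.
have /choice[g gP] t : exists k : {ffun 'I_n.+1 -> 'I_(b ^ m)}, cell k (x t).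
  by apply: unit_cube_cell => //; have [/Q01] := xP t.
have g0 t : g t ord0 = t.
  have [_ /(elementary_interval_refine _ b_gt0 c0_le (gP t))/(_ ord0)] := xP t.
  by rewrite /c0 /a0 eqxx subnn divn1 => /val_inj.
have x_inj : injective x.
  move=> t t' xtt'; have := gP t; rewrite xtt' => gt.
  by rewrite -(g0 t) -(g0 t') (cell_inj b_gt0 gt (gP t')).
exists [ffun t => g t], [ffun t => h t]; split.
- split=> [t|c c_sum t t' tt']; first by rewrite ffunE g0.
  have c_le j : (c j <= m)%N by rewrite -c_sum (bigD1 j)//= leq_addr.
  apply: x_inj; pose a j := (g t j %/ b ^ (m - c j))%N.
  have a_lt j : (a j < b ^ c j)%N.
    by rewrite ltn_divLR ?expn_gt0 ?b_gt0// -expnD subnKC.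
  have [y [_ y_uniq]] := Qnet c a a_lt c_sum.
  rewrite -(y_uniq (x t)); last first.
    split; first by have [] := xP t.
    exact/(elementary_interval_refine _ b_gt0 c_le (gP t)).
  apply: y_uniq; split; first by have [] := xP t'.
  apply/(elementary_interval_refine _ b_gt0 c_le (gP t')) => j.
  by have := tt' j; rewrite !ffunE.
- by move=> t t'; rewrite !ffunE => hh; apply: x_inj; rewrite -!hP hh.
- by move=> t; rewrite !ffunE hP.
Qed.

Lemma measurable_realizes g h : measurable (realizes g h).
Proof.
rewrite (_ : realizes g h = \bigcap_(t in [set: 'I_(b ^ m)]) (X (h t) @^-1` cell (g t))).
  apply: fin_bigcap_measurable => // t _.
  rewrite -[X in measurable X]setTI.
  by apply: measurable_funPT => //; exact: measurable_elementary_interval.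
by apply/seteqP; split=> omega gh t; [move=> _|]; apply: gh.
Qed.

Let realization : {pred pattern * selection} :=
  [pred gh : pattern * selection | `[< net_pattern gh.1 >] && injectiveb gh.2].

Lemma contains_netE :
  contains_net b m X = \bigcup_(gh in [set` realization]) realizes gh.1 gh.2.
Proof.
apply/seteqP; split=> [omega|omega [[g h]] /=].
  move=> /contains_net_realizes[g [h [g_net h_inj gh]]]; exists (g, h) => //=.
  by rewrite inE/=; apply/andP; split; [apply/asboolP | apply/injectiveP].
by rewrite inE/= => /andP[/asboolP g_net _]; exact: realizes_contains_net.
Qed.

Lemma measurable_contains_net : measurable (contains_net b m X).
Proof.
rewrite contains_netE; apply: fin_bigcup_measurable => // gh _.
exact: measurable_realizes.
Qed.

Hypothesis X_unif : forall i, uniform_on_cube (X i).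
Hypothesis X_indep : mutually_independent X.

Lemma prob_cell i (k : {ffun 'I_n.+1 -> 'I_(b ^ m)}) :
  P (X i @^-1` cell k) = ((b ^ (m * n.+1))%:R^-1)%:E.
Proof.
have := X_unif i (@measurable_elementary_interval R b n.+1 (fun=> m) (fun j => k j)).
rewrite -/(cell k) setIidl; last exact: cell_in_unit_cube.
by rewrite lebesgue_tuple_cell.
Qed.

Lemma prob_realizes g h : injective h ->
  P (realizes g h) = ((b ^ (m * n.+1))%:R^-1 ^+ (b ^ m))%:E.
Proof.
move=> h_inj.
pose J := [set h t | t in 'I_(b ^ m)]%SET.
(* Independence is stated for a family over all sample indices; those outside the image of [h] get
   the whole space. *)
pose A i : set (n.+1.-tuple R) := if [pick t | h t == i] is Some t then cell (g t) else setT.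
have Ah t : A (h t) = cell (g t).
  rewrite /A; case: pickP => [t' /eqP/h_inj -> //|/(_ t)]; by rewrite eqxx.
rewrite (_ : realizes g h = \bigcap_(i in [set` J]) (X i @^-1` A i)).
  rewrite X_indep; last first.
    move=> i; rewrite /A; case: pickP => [t _|_]; last exact: measurableT.
    exact: measurable_elementary_interval.
  rewrite big_imset/=; last by move=> t t' _ _; exact: h_inj.
  under eq_bigr do rewrite Ah prob_cell.
  rewrite -(big_morph EFin (@EFinM R) erefl) prodr_const.
  by rewrite card_ord.
apply/seteqP; split=> omega gh /=.
  by move=> i /imsetP[t _ ->] /=; rewrite Ah; exact: gh.
by move=> t; rewrite -Ah; apply: gh; apply/imsetP; exists t.
Qed.

(** Union bound over patterns and selections. Counting injective selections by a falling factorial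
    keeps the gain that [ffact_le_exp] exploits. *)
Lemma prob_contains_net_le :
  (P (contains_net b m X) <=
   (#|[set g : pattern | `[< net_pattern g >]]%SET|%:R * (N ^_ (b ^ m))%:R
    / (b ^ (m * n.+1))%:R ^+ (b ^ m))%:E)%E.
Proof.
rewrite contains_netE.
apply: le_trans (measure_bigcup_pred_le _ _ _) _.
  by move=> gh; exact: measurable_realizes.
rewrite (eq_bigr (fun=> ((b ^ (m * n.+1))%:R^-1 ^+ (b ^ m))%:E)); last first.
  by move=> gh /andP[_ /injectiveP]; exact: prob_realizes.
rewrite -(big_morph EFin (@EFinD R) erefl) sumr_const lee_fin -[X in X <= _]mulr_natl exprVn.
rewrite -natrM ler_pM2r ?invr_gt0 ?exprn_gt0 ?ltr0n ?expn_gt0 ?b_gt0//.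
rewrite ler_nat -[X in (N ^_ X)%N]card_ord -[X in (X ^_ _)%N]card_ord.
rewrite -card_inj_ffuns -cardsX; apply/eq_leq/eq_card => gh.
by rewrite !inE.
Qed.

(** Failure forces some cell of the fixed pattern to be missed by all [N] points. *)
Lemma prob_contains_net_ge g : net_pattern g ->
  ((1 - (b ^ m)%:R * (1 - (b ^ (m * n.+1))%:R^-1) ^+ N)%:E <=
   P (contains_net b m X))%E.
Proof.
move=> g_net; pose missed t := \bigcap_(i in [set: 'I_N]) (X i @^-1` (~` cell (g t))).
have mcell t : measurable (~` cell (g t) : set (n.+1.-tuple R)).
  by apply: measurableC; exact: measurable_elementary_interval.
have mmissed t : measurable (missed t).
  apply: fin_bigcap_measurable => // i _.
  rewrite -[X in measurable X]setTI.
  exact: measurable_funPT.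
have missedP t : P (missed t) = ((1 - (b ^ (m * n.+1))%:R^-1) ^+ N)%:E.
  rewrite /missed (_ : [set: 'I_N] = [set` [set: 'I_N]%SET]); last first.
    by apply/seteqP; split=> i //= _; rewrite inE.
  rewrite X_indep//.
  rewrite (eq_bigr (fun=> (1 - (b ^ (m * n.+1))%:R^-1)%:E)); last first.
    move=> i _; rewrite -preimage_setC probability_setC ?prob_cell ?EFinB//.
    rewrite -[X in measurable X]setTI.
    by apply: measurable_funPT => //; exact: measurable_elementary_interval.
  by rewrite -(big_morph EFin (@EFinM R) erefl) prodr_const cardsT card_ord.
have sub : ~` contains_net b m X `<=` \bigcup_(t in [set` predT]) missed t.
  move=> omega; apply: contra_notP => no_miss.
  have /choice[h hP] t : exists i, cell (g t) (X i omega).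
    apply: contrapT => /forallNP t_miss; apply: no_miss.
    by exists t => //= i _; exact: t_miss.
  apply: (@realizes_contains_net g [ffun t => h t]) => // t.
  by rewrite ffunE.
have mC := measurable_contains_net.
have : (P (~` contains_net b m X) <=
        ((b ^ m)%:R * (1 - (b ^ (m * n.+1))%:R^-1) ^+ N)%:E)%E.
  apply: (@le_trans _ _ (P (\bigcup_(t in [set` predT]) missed t))).
    apply: le_measure sub; rewrite inE; first exact: measurableC.
    by apply: fin_bigcup_measurable.
  apply: le_trans (measure_bigcup_pred_le _ _ _) _ => //.
  rewrite (eq_bigr (fun=> ((1 - (b ^ (m * n.+1))%:R^-1) ^+ N)%:E)); last first.
    by move=> t _; exact: missedP.
  rewrite -(big_morph EFin (@EFinD R) erefl) sumr_const card_ord.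
  by rewrite lee_fin mulr_natl.
rewrite probability_setC//.
rewrite -(fineK (fin_num_measure P _ mC)) -EFinB !lee_fin.
by rewrite !lerBlDr addrC.
Qed.

End NetEvents.

(** * The threshold *)

Lemma ln_succ_ge (R : realType) (b : nat) : (0 < b)%N ->
  b.+1%:R^-1 <= ln b.+1%:R - ln b%:R :> R.
Proof.
move=> b_gt0; have b0 : 0 < b%:R :> R by rewrite ltr0n.
have b1 : 0 < b.+1%:R :> R by rewrite ltr0n.
have q0 : 0 < b%:R / b.+1%:R :> R by rewrite divr_gt0.
have : ln (1 + (b%:R / b.+1%:R - 1)) <= b%:R / b.+1%:R - 1 :> R.
  by apply: le_ln1Dx; rewrite -subr_gt0 opprK subrK.
rewrite addrC subrK ln_div ?posrE//.
have -> : b%:R / b.+1%:R - 1 = - b.+1%:R^-1 :> R.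
  by rewrite -natr1; field; rewrite natr1 gt_eqF.
by rewrite lerNr opprB.
Qed.

(** The induction step reduces to [(b + 2) (ln (b + 1) - ln b) >= 1], a consequence of
    [ln_succ_ge]. *)
Lemma ln_fact_le (R : realType) (b : nat) : (2 <= b)%N ->
  ln b`!%:R <= (b%:R + 2) * ln b%:R - b%:R + 2 - 2 * ln 2 :> R.
Proof.
elim: b => [//|b IHb]; rewrite ltnS leq_eqVlt => /predU1P[<-|b_gt1].
  have : 0 <= ln 2 :> R by rewrite ln_ge0// ler1n.
  by rewrite (_ : 2`! = 2)%N//; lra.
have b_gt0 : (0 < b)%N by exact: ltnW.
have b0 : 0 < b%:R :> R by rewrite ltr0n.
rewrite factS natrM lnM ?posrE ?ltr0n ?fact_gt0//.
have := IHb b_gt1; have := ln_succ_ge R b_gt0.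
rewrite -(ler_pM2l (ltr0Sn R b)) divff ?pnatr_eq0// -natr1.
set x := ln (b%:R + 1); set y := ln b%:R => h1 h2.
have hb : (2 : R) <= b%:R by rewrite ler_nat.
have xy : 0 <= x - y by rewrite subr_ge0 ler_ln ?posrE ?addr_gt0// lerDl.
nra.
Qed.

Lemma natr_expn_expR (R : realType) (b k : nat) : (0 < b)%N ->
  (b ^ k)%:R = expR (k%:R * ln b%:R) :> R.
Proof. by move=> b_gt0; rewrite expRM_natl lnK ?posrE ?ltr0n// natrX. Qed.

Lemma net_thresholdE (R : realType) (b d m : nat) : (0 < b)%N ->
  net_threshold R b d m =
  expR ((m * d)%:R * ln b%:R - m%:R * (d%:R - 1) / b%:R * ln b`!%:R).
Proof.
move=> b_gt0; rewrite /net_threshold expRD expRN /powR.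
by rewrite gt_eqF ?ltr0n ?fact_gt0// natr_expn_expR.
Qed.

(** For [b = 2] the two sides agree. Otherwise the exponents differ by [m (d - 1) / b] times the
    slack in [ln_fact_le]. *)
Lemma net_threshold_ge (R : realType) (b d m : nat) : (2 <= b)%N -> (1 <= d)%N ->
  net_threshold R b d m >=
    if (b == 2)%N then 2 `^ (m%:R + m%:R * (d%:R - 1) / 2)
    else (b ^ m)%:R *
      expR (b%:R^-1 * (b%:R - 2 - 2 * (ln b%:R - ln 2))) ^+ (m * (d - 1))%N.
Proof.
move=> b_ge2 d_ge1; have b_gt0 : (0 < b)%N by exact: ltnW.
have b0 : 0 < b%:R :> R by rewrite ltr0n.
rewrite net_thresholdE//; case: eqP => [->|_].
  rewrite /powR gt_eqF ?ltr0n// ler_expR (_ : 2`! = 2)%N// natrM.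
  by lra.
rewrite natr_expn_expR// -expRM_natl -expRD ler_expR !natrM natrB//.
have := ln_fact_le R b_ge2; set L := ln b`!%:R; set l := ln b%:R => Lle.
have d1 : 0 <= d%:R - 1 :> R by rewrite subr_ge0 ler1n.
have mb : 0 <= m%:R * (d%:R - 1) / b%:R :> R by rewrite divr_ge0// mulr_ge0.
rewrite -subr_ge0.
have -> : m%:R * d%:R * l - m%:R * (d%:R - 1) / b%:R * L -
  (m%:R * l + m%:R * (d%:R - 1) * (b%:R^-1 * (b%:R - 2 - 2 * (l - ln 2)))) =
  (m%:R * (d%:R - 1) / b%:R) * ((b%:R + 2) * l - b%:R + 2 - 2 * ln 2 - L) :> R.
  by field; rewrite gt_eqF.
by rewrite mulr_ge0// subr_ge0.
Qed.

(** At [N] equal to the threshold, selections times switch settings exactly balance the probability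
    of one realization. Here [d] is the dimension minus one. *)
Lemma net_threshold_exp (R : realType) (b d m : nat) : (0 < b)%N -> (0 < m)%N ->
  net_threshold R b d.+1 m ^+ (b ^ m) * b`!%:R ^+ (d * m * b ^ m.-1) =
  (b ^ (m * d.+1))%:R ^+ (b ^ m).
Proof.
move=> b_gt0 m_gt0; rewrite /net_threshold exprMn exprVn.
have f0 : 0 < b`!%:R :> R by rewrite ltr0n fact_gt0.
have b0 : b%:R != 0 :> R by rewrite pnatr_eq0 -lt0n.
rewrite -(powR_mulrn (b ^ m) (powR_ge0 _ _)) -powRrM.
rewrite (_ : _ / b%:R * _ = (d * m * b ^ m.-1)%:R).
  by rewrite powR_mulrn ?divfK ?expf_eq0 ?gt_eqF ?andbF// ltW.
rewrite -{2}(prednK m_gt0) expnS !natrM -[d.+1%:R]natr1.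
by field.
Qed.

Lemma sum_ord_ge (R : realType) (n : nat) : (2 <= n)%N ->
  n%:R ^+ 2 / 4 <= \sum_(i < n) i%:R :> R.
Proof.
elim: n => [//|n IHn]; rewrite ltnS leq_eqVlt => /predU1P[<-|n_gt1].
  by rewrite !big_ord_recr big_ord0/=; lra.
have := IHn n_gt1; have : 2 <= n%:R :> R by rewrite ler_nat.
by rewrite big_ord_recr/= -natr1; nra.
Qed.

(* The factor exp(-1/4) is the birthday effect: the points of a net occupy     *)
(* distinct cells.                                                             *)
Lemma ffact_le_exp (R : realType) (N M : nat) (T : R) : (2 <= M)%N ->
  N%:R <= T -> 0 < T -> T <= M%:R ^+ 2 ->
  (N ^_ M)%:R <= expR (- (1 / 4)) * T ^+ M.
Proof.
move=> M2 NT T0 TM; rewrite ffact_prod natr_prod.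
apply: (@le_trans _ _ (\prod_(i < M) (T * expR (- (i%:R / T))))).
  apply: ler_prod => i _; rewrite ler0n/=.
  (* For [i >= N] the truncated factor is 0; otherwise [N - i <= T (1 - i / T) <= T exp (- i /
     T)]. *)
  have [Ni|iN] := leqP N i.
    by move: Ni; rewrite -subn_eq0 => /eqP ->; rewrite mulr_ge0 ?expR_ge0// ltW.
  rewrite natrB 1?ltnW//; apply: (@le_trans _ _ (T * (1 + - (i%:R / T)))).
    by rewrite mulrDr mulr1 mulrN mulrCA divff ?gt_eqF// mulr1 lerD2r.
  by rewrite ler_pM2l// expR_ge1Dx.
rewrite big_split/= prodr_const card_ord mulrC ler_pM2r ?exprn_gt0//.
rewrite -expR_sum ler_expR sumrN lerN2 -mulr_suml ler_pdivlMr//.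
by apply: le_trans (sum_ord_ge R M2); lra.
Qed.

(** * The two probability bounds *)

Section MainBounds.
Variables (R : realType) (disp : measure_display) (Omega : measurableType disp).
Variables (P : probability Omega R) (b m n N : nat).
Variable X : 'I_N -> {RV P >-> n.+1.-tuple R}.
Hypothesis b_ge2 : (2 <= b)%N.
Hypothesis X_unif : forall i, uniform_on_cube (X i).
Hypothesis X_indep : mutually_independent X.

Let b_gt0 : (0 < b)%N. Proof. exact: ltnW. Qed.

Lemma prob_contains_net_below_threshold : (2 <= m)%N ->
  N%:R < net_threshold R b n.+1 m ->
  (P (contains_net b m X) <= (expR (- (1 / 4)))%:E)%E.
Proof.
move=> m2 NT; have m_gt0 : (0 < m)%N by exact: ltnW.
apply: (le_trans (prob_contains_net_le m b_gt0 X_unif X_indep)); rewrite lee_fin.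
set T := net_threshold _ _ _ _ in NT.
have T0 : 0 < T by exact: le_lt_trans (ler0n _ _) NT.
have f0 : 0 < b`!%:R :> R by rewrite ltr0n fact_gt0.
rewrite ler_pdivrMr ?exprn_gt0 ?ltr0n ?expn_gt0 ?b_gt0//.
rewrite -net_threshold_exp// -/T.
(* In dimension at most 2 the factor exp(-1/4) comes from [ffact_le_exp] with [M = b ^ m]. *)
have [n_le1|n_ge2] := leqP n 1.
  rewrite mulrA [leRHS]mulrC; apply: ler_pM => //.
    by rewrite -natrX ler_nat; exact: card_net_pattern.
  apply: ffact_le_exp => //; last 1 first.
  - rewrite /T net_thresholdE// -natrX -expnM natr_expn_expR// ler_expR.
    have l0 : 0 <= ln b%:R :> R by rewrite ln_ge0// ler1n.
    have L0 : 0 <= ln b`!%:R :> R by rewrite ln_ge0// ler1n fact_gt0.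
    rewrite lerBlDr ler_wpDr//; last first.
      by rewrite ler_wpM2r// ler_nat leq_mul2l ltnS n_le1 orbT.
    by rewrite mulr_ge0// divr_ge0// mulr_ge0// subr_ge0 ler1n.
  - by rewrite (leq_trans b_ge2)// -{1}(expn1 b) leq_pexp2l.
  - exact: ltW.
(* In dimension at least 3 the redundant switch saves a factor b! >= 2, which pays for exp(-1/4) >=
   3/4. *)
have half : 1 <= expR (- (1 / 4)) * b`!%:R :> R.
  have e34 : 3 / 4 <= expR (- (1 / 4)) :> R.
    by apply: le_trans (expR_ge1Dx _); lra.
  have f2 : 2 <= b`!%:R :> R.
    by rewrite ler_nat (leq_trans b_ge2)// fact_geq.
  by nra.
have K_gt0 : (0 < n * m * b ^ m.-1)%N.
  by rewrite !muln_gt0 m_gt0 expn_gt0 b_gt0 !andbT ltnW.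
have cnt : (#|[set g : {ffun 'I_(b ^ m) -> {ffun 'I_n.+1 -> 'I_(b ^ m)}}
    | `[< net_pattern g >]]%SET| <= b`! ^ (n * m * b ^ m.-1).-1)%N.
  by case: n n_ge2 => [|[|k]]// _; exact: card_net_pattern_dim3.
have ffN : (N ^_ (b ^ m))%:R <= T ^+ (b ^ m).
  apply: (@le_trans _ _ (N%:R ^+ (b ^ m))).
    rewrite -natrX ler_nat ffact_prod -[X in (_ <= _ ^ X)%N]card_ord -prod_nat_const.
    by apply: leq_prod => i _; exact: leq_subr.
  by apply: lerXn2r; rewrite ?nnegrE ?ler0n ?(ltW T0)// ltW.
apply: (@le_trans _ _ (b`!%:R ^+ (n * m * b ^ m.-1).-1 * T ^+ (b ^ m))).
  by apply: ler_pM => //; rewrite -natrX ler_nat.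
rewrite -[in leRHS](prednK K_gt0) exprS.
rewrite [leRHS](_ : _ = expR (- (1 / 4)) * b`!%:R *
  (b`!%:R ^+ (n * m * b ^ m.-1).-1 * T ^+ (b ^ m))); last by ring.
by rewrite ler_peMl// mulr_ge0// exprn_ge0// ltW.
Qed.

Lemma prob_contains_net_above (eps : R) :
  (exists p k : nat, [/\ prime p, (0 < k)%N & b = (p ^ k)%N]) -> (n <= b)%N ->
  (1 + eps) * (b ^ (m * n.+1))%:R * m%:R * ln b%:R <= N%:R ->
  ((1 - expR (- (eps * ln b%:R)) ^+ m)%:E <= P (contains_net b m X))%E.
Proof.
move=> b_primepow n_le N_ge.
have [g g_net] := net_pattern_exists m b_primepow n_le.
apply: (le_trans _ (prob_contains_net_ge b_gt0 X_unif X_indep g_net)).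
rewrite lee_fin lerD2l lerN2.
set K := (b ^ (m * n.+1))%:R in N_ge *.
have K1 : 1 <= K by rewrite ler1n expn_gt0 b_gt0.
have K0 : 0 < K by exact: lt_le_trans ltr01 K1.
have b0 : 0 < b%:R :> R by rewrite ltr0n.
(* Since [1 - 1/K <= exp (- 1/K)], the failure bound is at most [exp (m ln b - N / K)], and
   [N / K >= (1 + eps) m ln b]. *)
apply: (@le_trans _ _ ((b ^ m)%:R * expR (- K^-1) ^+ N)).
  rewrite ler_pM2l ?ltr0n ?expn_gt0 ?b_gt0//; apply: lerXn2r.
  - by rewrite nnegrE subr_ge0 invf_le1.
  - by rewrite nnegrE expR_ge0.
  - exact: expR_ge1Dx.
rewrite natr_expn_expR// -!expRM_natl -expRD ler_expR.
have : (1 + eps) * m%:R * ln b%:R <= N%:R / K.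
  by rewrite ler_pdivlMr//; lra.
by rewrite mulrN; lra.
Qed.

End MainBounds.

Unset Implicit Arguments.

Theorem theorem3p1 (R : realType) (b d : nat)
    (b_ge2 : (2 <= b)%N)
    (b_primepow : exists p k : nat, [/\ prime p, (0 < k)%N & b = (p ^ k)%N])
    (d_ge1 : (1 <= d)%N) (d_le : (d <= b.+1)%N)
    (disp : nat -> measure_display)
    (Omega : forall N : nat, measurableType (disp N))
    (P : forall N : nat, probability (Omega N) R)
    (X : forall N : nat, 'I_N -> {RV (P N) >-> d.-tuple R})
    (X_unif : forall (N : nat) (i : 'I_N), uniform_on_cube (X N i))
    (X_indep : forall N : nat, mutually_independent (X N)) :
  (forall (eps : R) (N : nat -> nat),
     0 < eps ->
     (\forall m \near \oo,
        (1 + eps) * (b ^ (m * d))%:R * m%:R * ln b%:R <= (N m)%:R) ->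
     P (N m) (contains_net b m (X (N m))) @[m --> \oo] --> 1%E)
  /\
  (forall N : nat -> nat,
     P (N m) (contains_net b m (X (N m))) @[m --> \oo] --> 1%E ->
     \forall m \near \oo, net_threshold R b d m <= (N m)%:R)
  /\
  (forall m : nat, (2 <= m)%N ->
     net_threshold R b d m >=
       if (b == 2)%N then 2 `^ (m%:R + m%:R * (d%:R - 1) / 2)
       else (b ^ m)%:R *
         expR (b%:R^-1 * (b%:R - 2 - 2 * (ln b%:R - ln 2))) ^+ (m * (d - 1))%N).
Proof.
case: d => [//|n] in d_ge1 d_le X X_unif X_indep *.
have b_gt0 : (0 < b)%N by exact: ltnW.
have ln_b_gt0 : 0 < ln b%:R :> R by rewrite ln_gt0// ltr1n.
split; [|split].
- move=> eps N eps_gt0 N_ge.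
  pose r : R := expR (- (eps * ln b%:R)).
  have r_lt1 : `|r| < 1.
    by rewrite ger0_norm ?expR_ge0// expR_lt1 oppr_lt0 mulr_gt0.
  apply: (@squeeze_cvge _ _ _ _ (fun m => (1 - r ^+ m)%:E) _ (fun=> 1%E)).
  + near=> m; apply/andP; split.
      apply: (prob_contains_net_above b_ge2 (X_unif _) (X_indep _) b_primepow d_le).
      by near: m.
    apply: probability_le1; exact: measurable_contains_net.
  + apply: cvg_EFin; first by near=> m.
    rewrite -[X in _ --> X]subr0; apply: cvgB; first exact: cvg_cst.
    exact: cvg_expr.
  + exact: cvg_cst.
- move=> N cvg1.
  (* Convergence to 1 eventually pushes the probability above exp(-1/4), which is impossible below
     the threshold. *)
  have lt1 : ((expR (- (1 / 4)))%:E < 1%:E :> \bar R)%E.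
    by rewrite lte_fin expR_lt1; lra.
  have : \forall m \near \oo,
      ((expR (- (1 / 4)))%:E < P (N m) (contains_net b m (X (N m))))%E.
    apply: (cvg1 [set y | ((expR (- (1 / 4)))%:E < y)%E]).
    by apply: open_nbhs_nbhs; split => //; exact: open_ereal_gt_ereal.
  move=> gt; near=> m; rewrite leNgt; apply/negP => NT.
  have : ((expR (- (1 / 4)))%:E < P (N m) (contains_net b m (X (N m))))%E.
    by near: m.
  apply/negP; rewrite -leNgt.
  apply: (prob_contains_net_below_threshold b_ge2 (X_unif _) (X_indep _) _ NT).
  by near: m; exists 2%N.
- by move=> m _; exact: net_threshold_ge.
Unshelve. all: by end_near.
Qed.
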